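(* For every formula $A$ of $\mathcal L$, if $A$ is derivable in $\mathsf{MK}$, then $A$ is valid in every minimal birelational model.
   Context: $\mathcal L$ is the language $A ::= p \mid \bot \mid A\wedge A \mid A\vee A \mid A\to A \mid \Box A \mid \Diamond A$ over a countable set $\mathrm{Atm}$ of propositional variables. Minimal propositional logic $\mathsf{MPL}$ is axiomatised by $A\wedge B\to A$, $A\wedge B\to B$, $A\to A\vee B$, $B\to A\vee B$, $(A\to B)\to((A\to C)\to(A\to B\wedge C))$, $(A\to C)\to((B\to C)\to(A\vee B\to C))$, $(A\to(B\to C))\to((A\to B)\to(A\to C))$, $A\to(B\to A)$, and modus ponens. $\mathsf{MK}$ extends $\mathsf{MPL}$ over $\mathcal L$ with the axioms $\Box(A\to B)\to(\Box A\to\Box B)$, $\Box(A\to B)\to(\Diamond A\to\Diamond B)$ and the rule $A/\Box A$. A minimal birelational model is a tuple $\langle W,\le,F,R,V\rangle$ with $W\neq\emptyset$, $\le$ a reflexive transitive relation on $W$, $F\subseteq W$ upward closed under $\le$ (the fallible worlds), $R$ a binary relation on $W$, and $V:\mathrm{Atm}\to\mathcal P(W)$ with each $V(p)$ upward closed under $\le$. Forcing: $w\Vdash p$ iff $w\in V(p)$; $w\Vdash\bot$ iff $w\in F$; $\wedge,\vee$ pointwise; $w\Vdash B\to C$ iff for all $v\ge w$, $v\Vdash B$ implies $v\Vdash C$; $w\Vdash\Box B$ iff for all $v\ge w$ and all $u$ with $vRu$, $u\Vdash B$; $w\Vdash\Diamond B$ iff for all $v\ge w$ there is $u$ with $vRu$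 and $u\Vdash B$. $A$ is valid in a model if it is forced at every world. *)

(* Defs.v *)
From Stdlib Require Import RelationClasses.
From mathcomp Require Import all_boot.

Set Implicit Arguments.
Unset Strict Implicit.
Unset Printing Implicit Defensive.

Inductive form (Atm : Type) : Type :=
| Var of Atm
| Bot
| And of form Atm & form Atm
| Or of form Atm & form Atm
| Imp of form Atm & form Atm
| Box of form Atm
| Dia of form Atm.

Arguments Bot {Atm}.

Declare Scope form_scope.
Delimit Scope form_scope with form.
Bind Scope form_scope with form.

Notation "□ A" := (Box A) (at level 35, right associativity) : form_scope.
Notation "◇ A" := (Dia A) (at level 35, right associativity) : form_scope.
Notation "A ⋏ B" := (And A B) (at level 40, left associativity) : form_scope.
Notation "A ⋎ B" := (Or A B) (at level 50, left associativity) : form_scope.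
Notation "A ⊃ B" := (Imp A B) (at level 55, right associativity) : form_scope.

(* [Bot] has no axiom of its own: minimal logic lacks ex falso.  The schemas
   range over all modal formulas. *)
Inductive MPL_axiom (Atm : Type) : form Atm -> Prop :=
| ax_and_l A B : MPL_axiom (A ⋏ B ⊃ A)
| ax_and_r A B : MPL_axiom (A ⋏ B ⊃ B)
| ax_or_l A B : MPL_axiom (A ⊃ A ⋎ B)
| ax_or_r A B : MPL_axiom (B ⊃ A ⋎ B)
| ax_and_i A B C : MPL_axiom ((A ⊃ B) ⊃ ((A ⊃ C) ⊃ (A ⊃ B ⋏ C)))
| ax_or_e A B C : MPL_axiom ((A ⊃ C) ⊃ ((B ⊃ C) ⊃ (A ⋎ B ⊃ C)))
| ax_s A B C : MPL_axiom ((A ⊃ (B ⊃ C)) ⊃ ((A ⊃ B) ⊃ (A ⊃ C)))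
| ax_k A B : MPL_axiom (A ⊃ (B ⊃ A)).

Inductive MK (Atm : Type) : form Atm -> Prop :=
| MK_MPL A : MPL_axiom A -> MK A
| MK_K_box A B : MK (□ (A ⊃ B) ⊃ (□ A ⊃ □ B))
| MK_K_dia A B : MK (□ (A ⊃ B) ⊃ (◇ A ⊃ ◇ B))
| MK_mp A B : MK (A ⊃ B) -> MK A -> MK B
| MK_nec A : MK A -> MK (□ A).

Definition up_closed (W : Type) (le : W -> W -> Prop) (X : W -> Prop) : Prop :=
  forall w v : W, le w v -> X w -> X v.

(* No frame condition relates [le] and [acc]. *)
Record model (Atm : Type) : Type := Model {
  world :> Type;
  le : world -> world -> Prop;
  fallible : world -> Prop;
  acc : world -> world -> Prop;
  valuation : Atm -> world -> Prop;
  world_inhabited : inhabited world;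
  le_preorder : PreOrder le;
  fallible_up : up_closed le fallible;
  valuation_up : forall p : Atm, up_closed le (valuation p)
}.

Fixpoint forces (Atm : Type) (M : model Atm) (w : M) (A : form Atm) : Prop :=
  match A with
  | Var p => valuation p w
  | Bot => fallible w
  | And B C => forces w B /\ forces w C
  | Or B C => forces w B \/ forces w C
  | Imp B C => forall v : M, le w v -> forces v B -> forces v C
  | Box B => forall v : M, le w v -> forall u : M, acc v u -> forces u B
  | Dia B => forall v : M, le w v -> exists u : M, acc v u /\ forces u B
  end.

Definition valid (Atm : Type) (M : model Atm) (A : form Atm) : Prop :=
  forall w : M, forces w A.

(* Main.v *)
Require Import Defs.
From mathcomp Require Import all_boot.

(** Induction on the derivation, with the model fixed: each axiom is forced at every world and both
    rules preserve this. Propositional axioms are handled by [MPL_axiom_valid], where persistence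
    ([forces_up]) enters only for [A ⊃ (B ⊃ A)]; the other steps rest on [le] being a preorder. *)

Lemma le_refl (Atm : Type) (M : model Atm) (w : M) : le w w.
Proof. by case: (le_preorder M) => lexx _; apply: lexx. Qed.

Lemma le_trans (Atm : Type) (M : model Atm) (v u w : M) :
  le u v -> le v w -> le u w.
Proof. by case: (le_preorder M) => _ letr; apply: letr. Qed.

(* The modal cases need no condition linking [le] and [acc], because the
   forcing clauses for Box and Dia quantify over all [le]-successors. *)
Lemma forces_up (Atm : Type) (M : model Atm) (A : form Atm) :
  up_closed (@le _ M) (fun w : M => forces w A).
Proof.
elim: A => [p||B IHB C IHC|B IHB C IHC|B _ C _|B _|B _] w v wv /=.
- exact: valuation_up wv.
- exact: fallible_up wv.
- by case=> wB wC; split; [apply: IHB wv wB | apply: IHC wv wC].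
- by case=> [wB|wC]; [left; apply: IHB wv wB | right; apply: IHC wv wC].
- by move=> wBC u vu; apply: wBC; apply: le_trans vu.
- by move=> wB u vu; apply: wB; apply: le_trans vu.
- by move=> wB u vu; apply: wB; apply: le_trans vu.
Qed.

Lemma MPL_axiom_valid (Atm : Type) (M : model Atm) (A : form Atm) :
  MPL_axiom A -> valid M A.
Proof.
case=> {A} [A B|A B|A B|A B|A B C|A B C|A B C|A B] w /=.
- by move=> v _ [].
- by move=> v _ [].
- by move=> v _; left.
- by move=> v _; right.
- move=> v1 _ AB v2 v12 AC v3 v23 v3A.
  by split; [apply: AB (le_trans _ _ _ _ _ v12 v23) v3A | apply: AC v23 v3A].
- move=> v1 _ AC v2 v12 BC v3 v23 [v3A|v3B].
    exact: AC (le_trans _ _ _ _ _ v12 v23) v3A.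
  exact: BC v23 v3B.
- move=> v1 _ ABC v2 v12 AB v3 v23 v3A.
  apply: (ABC v3 (le_trans _ _ _ _ _ v12 v23) v3A v3 (le_refl _ _ _)).
  exact: AB v23 v3A.
- by move=> v1 _ v1A v2 v12 _; apply: forces_up v12 v1A.
Qed.

Theorem mainTheorem2 (Atm : countType) (A : form Atm) :
  MK A -> forall M : model Atm, valid M A.
Proof.
move=> mkA M.
elim: mkA => {A} [A|A B|A B|A B _ AB _ vA|A _ vA] /=.
- exact: MPL_axiom_valid.
- move=> w v1 _ AB v2 v12 vA v3 v23 u v3u.
  (* The boxed implication is forced at the [acc]-successor [u] of [v3]; reflexivity of [le] lets it
     be used at [u] itself. *)
  apply: (AB v3 (le_trans _ _ _ _ _ v12 v23) u v3u u (le_refl _ _ _)).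
  exact: vA v23 u v3u.
- move=> w v1 _ AB v2 v12 vA v3 v23.
  (* The successor witnessing [◇ A] at [v3] also witnesses [◇ B], since [□ (A ⊃ B)] reaches every
     successor of [v3]. *)
  have [u [v3u uA]] := vA v3 v23; exists u; split=> //.
  exact: (AB v3 (le_trans _ _ _ _ _ v12 v23) u v3u u (le_refl _ _ _)).
- by move=> w; apply: AB (le_refl _ _ _) (vA w).
(* Necessitation: the premise is forced at all worlds, hence at [u]. *)
- by move=> w v _ u _; apply: vA.
Qed.
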